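(* Let $(F_i,X_i,C_i)_{i\ge1}$ be i.i.d. copies of a finite-alphabet triple $(F,X,C)$, let $S=\eta(X,C)\triangleq P_{F\mid X,C}(\cdot\mid X,C)$ with finite support $\mathcal S$, let $\widehat{\mathcal S}$ be a finite reproduction alphabet with $\mathcal S\cup\widehat{\mathcal S}\subseteq\mathcal Q$, and let $d_p(s,\widehat s)=D_L(s\|\widehat s)$, assumed finite on $\mathcal S\times\widehat{\mathcal S}$. Then for every $D\ge0$, $$R_{X\to S}^{\mathrm{ind}}(D)=\inf_{\substack{W_{\widehat S\mid X,C}:\\ \mathbb E_W[d_p(S,\widehat S)]\le D}}I_W(X;\widehat S\mid C)=\inf_{\substack{Q_{\widehat S\mid S,C}:\\ \mathbb E_Q[d_p(S,\widehat S)]\le D}}I_Q(S;\widehat S\mid C)=R_S^{\mathrm{dir}}(D),$$ where the infima range over test channels with output alphabet $\widehat{\mathcal S}$.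
   Context: $F,X,C$ take values in finite sets $\mathcal F,\mathcal X,\mathcal C$. $\mathcal Q\subseteq\mathcal P(\mathcal F)$ is a class of probability distributions on $\mathcal F$ and $L:\mathcal Q\times\mathcal F\to\overline{\mathbb R}$ is a proper loss: with $R_L(P,Q)=\mathbb E_{F\sim P}[L(Q,F)]$, one has $R_L(P,P)\le R_L(P,Q)$ for all $P,Q\in\mathcal Q$. $D_L(P\|Q)=R_L(P,Q)-R_L(P,P)$. Set $S_i=\eta(X_i,C_i)$. The sequence $C^n=(C_1,\dots,C_n)$ is available noncausally at both encoder and decoder. An $(n,M_n)$ *indirect code* is a pair $f_n^X:\mathcal X^n\times\mathcal C^n\to\{1,\dots,M_n\}$, $g_n^X:\{1,\dots,M_n\}\times\mathcal C^n\to\widehat{\mathcal S}^{\,n}$, with reconstruction $\widehat S^n=g_n^X(f_n^X(X^n,C^n),C^n)$. An $(n,M_n)$ *direct state code* is a pair $f_n^S:\mathcal S^n\times\mathcal C^n\to\{1,\dots,M_n\}$, $g_n^S:\{1,\dots,M_n\}\times\mathcal C^n\to\widehat{\mathcal S}^{\,n}$, with reconstruction $\widehat S^n=g_n^S(f_n^S(S^n,C^n),C^n)$. In either problem the average distortion is $D_n=\frac1n\sum_{i=1}^n\mathbb E[d_p(S_i,\widehat S_i)]$. A rate $R$ is *achievable at distortion $D$* if there is a sequence of the corresponding codes with $\limsup_{n\to\infty}\frac1n\log M_n\le R$ and $\limsup_{n\to\infty}D_n\le D$. $R_{X\to S}^{\mathrm{ind}}(D)$ and $R_S^{\mathrm{dir}}(D)$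 are the infima of achievable rates in the indirect and direct problems (infimum of the empty set is $+\infty$). $I_W$, $\mathbb E_W$ are computed under $P_{X,C}W_{\widehat S\mid X,C}$ with $S=\eta(X,C)$; $I_Q$, $\mathbb E_Q$ under $P_{S,C}Q_{\widehat S\mid S,C}$. The same logarithm base is used for rates and mutual information. *)

(* Defs.v *)
From mathcomp Require Import all_boot all_order all_algebra finmap.
From mathcomp Require Import all_classical all_reals all_analysis.

Set Implicit Arguments.
Unset Strict Implicit.
Unset Printing Implicit Defensive.

Import Order.TTheory GRing.Theory Num.Theory.

Local Open Scope fset_scope.
Local Open Scope classical_set_scope.
Local Open Scope ring_scope.

Section Distributions.
Context {R : realType}.

Definition is_pmf (T : finType) (p : {ffun T -> R}) : Prop :=
  (forall t, 0 <= p t) /\ \sum_t p t = 1.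

Definition logb (b x : R) : R := ln x / ln b.

(* With 0 * +oo = 0 * -oo = 0, this is the expectation of g whenever the
   latter is defined; an undefined +oo - oo evaluates to -oo. *)
Definition expect (T : finType) (p : {ffun T -> R}) (g : T -> \bar R) : \bar R :=
  (\sum_t (p t)%:E * g t)%E.

End Distributions.

Section Losses.
Context {R : realType} {F : finType}.

(* Distributions on F are finite functions subject to [is_pmf]; a loss is total,
   but only its values on the class Q are constrained by [proper_loss]. *)
Definition risk (L : {ffun F -> R} -> F -> \bar R) (p q : {ffun F -> R}) : \bar R :=
  expect p (L q).

Definition proper_loss (Q : set {ffun F -> R}) (L : {ffun F -> R} -> F -> \bar R) : Prop :=
  forall p q, Q p -> Q q -> (risk L p p <= risk L p q)%E.

(* +oo - oo = -oo + oo = -oo, so [divergence L p q \is a fin_num] holds exactly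
   when both risks are defined and finite. *)
Definition divergence (L : {ffun F -> R} -> F -> \bar R) (p q : {ffun F -> R}) : \bar R :=
  (risk L p q - risk L p p)%E.

End Losses.

Section State.
Context {R : realType} {F X C : finType}.
Variable P : {ffun F * X * C -> R}.

Definition law_XC : {ffun X * C -> R} :=
  [ffun xc => \sum_f P (f, xc.1, xc.2)].

(* P_{F|X,C}(.|x,c); it is the zero function when P_{X,C}(x,c) = 0, and such
   pairs (x,c) do not contribute to the state alphabet. *)
Definition eta (xc : X * C) : {ffun F -> R} :=
  [ffun f => P (f, xc.1, xc.2) / law_XC xc].

Definition states : {fset {ffun F -> R}} :=
  [fset eta xc | xc in [set xc : X * C | 0 < law_XC xc]%SET].

Definition law_SC : {ffun states * C -> R} :=
  [ffun sc => \sum_(x | eta (x, sc.2) == val sc.1) law_XC (x, sc.2)].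

End State.

(* A memoryless source with letters (a,c) of law p, where the encoder observes
   a^n, both terminals observe c^n, and d (a,c) y is the per-letter distortion
   of the reproduction y. *)
Section Source.
Context {R : realType} {A C B : finType}.
Variables (p : {ffun A * C -> R}) (d : A * C -> B -> \bar R).

Record code (n M : nat) := Code {
  encode : {ffun 'I_n -> A} -> {ffun 'I_n -> C} -> 'I_M;
  decode : 'I_M -> {ffun 'I_n -> C} -> {ffun 'I_n -> B}
}.

Definition iid_law (n : nat) : {ffun {ffun 'I_n -> A * C} -> R} :=
  [ffun w : {ffun 'I_n -> A * C} => \prod_(i < n) p (w i)].

Definition reconstruction n M (k : code n M) (w : {ffun 'I_n -> A * C}) :
    {ffun 'I_n -> B} :=
  let an := [ffun i => (w i).1] in
  let cn := [ffun i => (w i).2] in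
  decode k (encode k an cn) cn.

Definition avg_distortion n M (k : code n M) : \bar R :=
  ((n%:R^-1)%:E *
   \sum_(i < n) expect (iid_law n) (fun w => d (w i) (reconstruction k w i)))%E.

Definition achievable (b D r : R) : Prop :=
  exists (M : nat -> nat) (k : forall n, code n (M n)),
    (limn_esup (fun n => (n%:R^-1 * logb b (M n)%:R)%:E) <= r%:E)%E /\
    (limn_esup (fun n => avg_distortion (k n)) <= D%:E)%E.

Definition operational_rate (b D : R) : \bar R :=
  ereal_inf [set r%:E | r in [set r | achievable b D r]].

Definition channel (W : A * C -> {ffun B -> R}) : Prop :=
  forall ac, is_pmf (W ac).

Definition joint (W : A * C -> {ffun B -> R}) : {ffun A * C * B -> R} :=
  [ffun t => p t.1 * W t.1 t.2].

(* I(A;B|C); the terms with j (a,c,y) = 0 vanish, as 0 * log(0/0) should. *)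
Definition cond_mutual_info (b : R) (j : {ffun A * C * B -> R}) : R :=
  let jC c := \sum_a \sum_y j (a, c, y) in
  let jAC a c := \sum_y j (a, c, y) in
  let jCB c y := \sum_a j (a, c, y) in
  \sum_a \sum_c \sum_y
    j (a, c, y) *
    logb b ((j (a, c, y) / jC c) / ((jAC a c / jC c) * (jCB c y / jC c))).

Definition information_rate (b D : R) : \bar R :=
  ereal_inf
    [set (cond_mutual_info b (joint W))%:E | W in
      [set W : A * C -> {ffun B -> R} |
        channel W /\
        (expect (joint W) (fun t => d t.1 t.2) <= D%:E)%E]].

End Source.

Section Problems.
Context {R : realType} {F X C : finType}.
Variables (P : {ffun F * X * C -> R}) (L : {ffun F -> R} -> F -> \bar R).
Variable Shat : {fset {ffun F -> R}}.

Definition dist_ind (xc : X * C) (t : Shat) : \bar R :=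
  divergence L (eta P xc) (val t).

Definition dist_dir (sc : states P * C) (t : Shat) : \bar R :=
  divergence L (val sc.1) (val t).

Definition R_ind (b D : R) : \bar R := operational_rate (law_XC P) dist_ind b D.

Definition R_dir (b D : R) : \bar R := operational_rate (law_SC P) dist_dir b D.

Definition I_ind (b D : R) : \bar R := information_rate (law_XC P) dist_ind b D.

Definition I_dir (b D : R) : \bar R := information_rate (law_SC P) dist_dir b D.

End Problems.

(* Main.v *)
Require Import Defs.
From mathcomp Require Import all_boot all_order all_algebra finmap.
From mathcomp Require Import all_classical all_reals all_analysis.
From mathcomp Require Import ring lra.

(** Both problems are instances of one lossy source coding problem with side
    information C available at both terminals, for which the operational rate
    equals the single-letter rate.

    Converse: let W be the test channel obtained by averaging the code over time,
    with output law q(y|c), and let Z be the product over the block of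
    W(y|a,c) / q(y|c) along the code. Then E[ln Z] = n I(W), while E[Z] <= M,
    because the sum of Z over all M codewords dominates it and each codeword
    contributes at most 1; Jensen's inequality gives n I(W) <= ln M. As the code
    only meets the distortion level asymptotically, a limit of such channels is
    taken, using compactness and the continuity of x ln x.

    Achievability: for each side information sequence draw M codewords from q;
    change of measure on typical pairs bounds the probability of missing, and
    Chebyshev's inequality with tolerance of order n^(-1/4) bounds the atypical
    part.

    Single-letter equality: the distortion depends on (x,c) only through (s,c).
    A channel from (s,c) lifts to (x,c) with the same information, and averaging a
    channel from (x,c) over the fibres of the state does not increase it, by Gibbs'
    inequality. *)

Set Implicit Arguments.
Unset Strict Implicit.
Unset Printing Implicit Defensive.

Import Order.TTheory GRing.Theory Num.Theory.
Import numFieldNormedType.Exports.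

Local Open Scope classical_set_scope.
Local Open Scope ring_scope.

(** * Sums over product spaces *)

Section FiniteSums.
Context {R : realType}.

(** The side information is put outermost, because decoders and codebooks are treated separately for
    each of its sequences. *)
Lemma sum_ffun_pair (I A C : finType) (g : {ffun I -> A * C} -> R) :
  \sum_w g w =
  \sum_(cn : {ffun I -> C}) \sum_(an : {ffun I -> A}) g [ffun i => (an i, cn i)].
Proof.
rewrite pair_bigA /=.
rewrite (reindex (fun q : {ffun I -> C} * {ffun I -> A} =>
  [ffun i => (q.2 i, q.1 i)])) //=.
exists (fun w : {ffun I -> A * C} => ([ffun i => (w i).2], [ffun i => (w i).1])).
  by case=> cn an _; congr (_, _); apply/ffunP => i; rewrite !ffunE.
by move=> w _; apply/ffunP => i; rewrite !ffunE; case: (w i).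
Qed.

Lemma sum_prod_ffun (I T : finType) (F : I -> T -> R) :
  \sum_(w : {ffun I -> T}) \prod_i F i (w i) = \prod_i \sum_t F i t.
Proof. by rewrite bigA_distr_bigA. Qed.

(** Used to pick one codebook from a random ensemble. If every value exceeded [v], the nonnegative
    terms [w t * (f t - v)] would have sum at most 0, so all weights would vanish. *)
Lemma exists_le_average (T : finType) (w f : T -> R) (v : R) :
  (forall t, 0 <= w t) -> \sum_t w t = 1 -> \sum_t w t * f t <= v ->
  exists t, f t <= v.
Proof.
move=> w0 w1 wf; apply: contrapT => /forallNP H.
have {}H t : v < f t by rewrite ltNge; apply/negP/H.
have : \sum_t w t * (f t - v) <= 0.
  under eq_bigr do rewrite mulrBr.
  by rewrite sumrB -mulr_suml w1 mul1r subr_le0.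
move=> le0.
have ge0 t : true -> 0 <= w t * (f t - v).
  by move=> _; rewrite mulr_ge0 ?w0// subr_ge0 ltW.
have eq0 : \sum_t w t * (f t - v) = 0.
  by apply/eqP; rewrite eq_le le0 sumr_ge0.
have : \sum_t w t = 0.
  apply: big1 => t _; move/eqP: eq0; rewrite psumr_eq0// => /allP/(_ t).
  rewrite mem_index_enum => /(_ isT); rewrite mulf_eq0 subr_eq0 (gt_eqF (H t)).
  by rewrite orbF => /eqP.
by rewrite w1 => /eqP; rewrite oner_eq0.
Qed.

Lemma pmf_exists_gt0 (T : finType) (p : {ffun T -> R}) :
  is_pmf p -> exists t, 0 < p t.
Proof.
move=> [p0 p1]; apply: contrapT => /forallNP H.
have : \sum_t p t = 0.
  apply: big1 => t _; apply/eqP; rewrite eq_le p0 andbT leNgt.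
  exact/negP/H.
by rewrite p1 => /eqP; rewrite oner_eq0.
Qed.

Lemma iid_pmf (T : finType) (I : finType) (p : T -> R) :
  \sum_t p t = 1 -> \sum_(w : {ffun I -> T}) \prod_i p (w i) = 1.
Proof. by move=> p1; rewrite (sum_prod_ffun (fun=> p)) big1. Qed.

Lemma iid_mean (T : finType) (n : nat) (p : T -> R) (g : T -> R) (i : 'I_n) :
  \sum_t p t = 1 ->
  \sum_(w : {ffun 'I_n -> T}) (\prod_k p (w k)) * g (w i) = \sum_t p t * g t.
Proof.
move=> p1.
under eq_bigr => w _.
  (* The factor [g (w i)] is written as a product that is 1 away from [i], so that the sum over
     words factorises. *)
  rewrite (_ : _ * _ = \prod_k (p (w k) * (if k == i then g (w k) else 1))); last first.
    by rewrite big_split/= -big_mkcond/= big_pred1_eq.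
  over.
rewrite (sum_prod_ffun (fun k t => p t * (if k == i then g t else 1))).
rewrite (bigD1 i)//= eqxx [X in _ * X]big1 ?mulr1// => k /negbTE ->.
by under eq_bigr do rewrite mulr1.
Qed.

Lemma iid_mean2 (T : finType) (n : nat) (p : T -> R) (g : T -> R) (i j : 'I_n) :
  \sum_t p t = 1 -> i != j ->
  \sum_(w : {ffun 'I_n -> T}) (\prod_k p (w k)) * (g (w i) * g (w j)) =
  (\sum_t p t * g t) ^+ 2.
Proof.
move=> p1 ij.
under eq_bigr => w _.
  rewrite (_ : _ * _ = \prod_k (p (w k) * ((if k == i then g (w k) else 1)
      * (if k == j then g (w k) else 1)))); last first.
    by rewrite !big_split/= -!big_mkcond/= !big_pred1_eq.
  over.
rewrite (sum_prod_ffun (fun k t => p t * ((if k == i then g t else 1) *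
  (if k == j then g t else 1)))).
rewrite (bigD1 i)//= (bigD1 j)/=; last by rewrite eq_sym.
rewrite eqxx (negbTE ij) eq_sym (negbTE ij) eqxx [X in _ * (_ * X)]big1; last first.
  move=> k /andP[/negbTE -> /negbTE ->].
  by under eq_bigr do rewrite !mulr1.
rewrite mulr1 expr2; congr (_ * _); apply: eq_bigr => t _; ring.
Qed.

(** Cross terms vanish by independence and centring; the n diagonal terms remain. *)
Lemma iid_variance (T : finType) (n : nat) (p : T -> R) (g : T -> R) :
  \sum_t p t = 1 -> \sum_t p t * g t = 0 ->
  \sum_(w : {ffun 'I_n -> T}) (\prod_k p (w k)) * (\sum_i g (w i)) ^+ 2 =
  n%:R * \sum_t p t * g t ^+ 2.
Proof.
move=> p1 g0.
under eq_bigr do rewrite expr2 big_distrlr/= mulr_sumr.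
rewrite exchange_big/=.
under eq_bigr => i _.
  under eq_bigr do rewrite mulr_sumr.
  rewrite exchange_big/= (bigD1 i)//= [X in _ + X]big1 ?addr0; last first.
    by move=> j ji; rewrite (@iid_mean2 _ _ p g) 1?eq_sym// g0 expr0n.
  rewrite (@iid_mean _ _ _ (fun t => g t * g t))//.
  over.
by rewrite sumr_const card_ord mulr_natl.
Qed.

(** On the event the centred sum is at least n c, so the indicator is at most its square over (n
    c)^2; [iid_variance] evaluates the mean of that square. *)
Lemma iid_chebyshev (T : finType) (n : nat) (p : T -> R) (g : T -> R) (m c : R) :
  (forall t, 0 <= p t) -> \sum_t p t = 1 -> \sum_t p t * g t = m ->
  0 < c -> (0 < n)%N ->
  \sum_(w : {ffun 'I_n -> T}) (\prod_k p (w k)) *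
    (n%:R * (m + c) < \sum_i g (w i))%R%:R <=
  (\sum_t p t * (g t - m) ^+ 2) / (n%:R * c ^+ 2).
Proof.
move=> p0 p1 gm c0 n0.
have nR : 0 < n%:R :> R by rewrite ltr0n.
have -> : (\sum_t p t * (g t - m) ^+ 2) / (n%:R * c ^+ 2) =
   (n%:R * \sum_t p t * (g t - m) ^+ 2) / (n%:R * c) ^+ 2.
  by field; rewrite !gt_eqF.
rewrite -iid_variance//; last first.
  under eq_bigr do rewrite mulrBr.
  by rewrite sumrB -mulr_suml p1 mul1r gm subrr.
rewrite mulr_suml; apply: ler_sum => w _; rewrite -mulrA ler_wpM2l ?prodr_ge0//.
case: ltP => [H|_]; last by rewrite mulr0n divr_ge0 ?sqr_ge0.
rewrite mulr1n ler_pdivlMr ?exprn_gt0 ?mulr_gt0// mul1r ler_sqr ?nnegrE.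
- rewrite sumrB sumr_const card_ord -[m *+ n]mulr_natl lerBrDl -mulrDr; exact: ltW.
- by rewrite mulr_ge0 ?ltW.
- rewrite sumrB sumr_const card_ord -[m *+ n]mulr_natl subr_ge0; apply/ltW/(lt_trans _ H).
  by rewrite ltr_pM2l// ltrDl.
Qed.

End FiniteSums.

(** * Single-letter quantities *)

Section Information.
Context {R : realType} {A C B : finType}.
Variable p : {ffun A * C -> R}.
Implicit Types (W : A * C -> {ffun B -> R}) (phi : A * C -> B -> R).

Definition side_law (c : C) : R := \sum_a p (a, c).

Definition mean W phi : R := \sum_ac p ac * \sum_y W ac y * phi ac y.

(** The conditional output law q(y|c). At a null [c] the division by zero makes it identically 0, so
    it is a law only where [side_law c] is positive. *)
Definition output W (c : C) (y : B) : R :=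
  (\sum_a p (a, c) * W (a, c) y) / side_law c.

(** Measured in nats; the base [b] enters only through division by [ln b]. *)
Definition info_density W (ac : A * C) (y : B) : R :=
  ln (W ac y / output W ac.2 y).

Definition mutual_info W : R := mean W (info_density W).

Hypothesis hp : is_pmf p.

Let p_ge0 ac : 0 <= p ac. Proof. by case: hp. Qed.
Let p_sum1 : \sum_ac p ac = 1. Proof. by case: hp. Qed.

Lemma side_law_ge0 c : 0 <= side_law c. Proof. exact: sumr_ge0. Qed.

Lemma le_side_law ac : p ac <= side_law ac.2.
Proof.
by case: ac => a c; rewrite /side_law (bigD1 a)//= lerDl sumr_ge0.
Qed.

Lemma side_law_gt0 ac : 0 < p ac -> 0 < side_law ac.2.
Proof. by move/lt_le_trans; apply; exact: le_side_law. Qed.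

Lemma side_law_eq0 ac : side_law ac.2 = 0 -> p ac = 0.
Proof.
by move=> H; apply/eqP; rewrite eq_le p_ge0 -H le_side_law.
Qed.

Lemma side_law_sum1 : \sum_c side_law c = 1.
Proof.
by rewrite -p_sum1 exchange_big pair_bigA/=; apply: eq_bigr => -[].
Qed.

Lemma outputM W c y : side_law c * output W c y = \sum_a p (a, c) * W (a, c) y.
Proof.
rewrite /output mulrC; have [c0|c0] := eqVneq (side_law c) 0; last by rewrite divfK.
rewrite c0 mulr0 big1// => a _.
by rewrite (@side_law_eq0 (a, c))// mul0r.
Qed.

Lemma mean_pair W phi :
  mean W phi = \sum_c \sum_y \sum_a p (a, c) * W (a, c) y * phi (a, c) y.
Proof.
rewrite /mean (eq_bigr (fun ac => p (ac.1, ac.2) *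
  \sum_y W (ac.1, ac.2) y * phi (ac.1, ac.2) y)); last by case.
rewrite -(pair_bigA _ (fun a c => p (a, c) *
  \sum_y W (a, c) y * phi (a, c) y))/= exchange_big/=.
apply: eq_bigr => c _; rewrite exchange_big/=.
by apply: eq_bigr => a _; rewrite mulr_sumr; apply: eq_bigr => y _; rewrite mulrA.
Qed.

Lemma mean_output W (g : C -> B -> R) :
  mean W (fun ac y => g ac.2 y) = \sum_c side_law c * \sum_y output W c y * g c y.
Proof.
rewrite mean_pair; apply: eq_bigr => c _; rewrite mulr_sumr.
by apply: eq_bigr => y _; rewrite mulrA outputM mulr_suml.
Qed.

Lemma expect_joint W phi :
  expect (joint p W) (fun t => (phi t.1 t.2)%:E) = (mean W phi)%:E.
Proof.
rewrite /expect sumEFin; congr EFin; rewrite /mean.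
under [RHS]eq_bigr do rewrite mulr_sumr.
rewrite pair_bigA/=; apply: eq_bigr => t _.
by rewrite ffunE mulrA.
Qed.

Section Channel.
Variable W : A * C -> {ffun B -> R}.
Hypothesis hW : channel W.

Lemma channel_ge0 ac y : 0 <= W ac y. Proof. by case: (hW ac). Qed.
Lemma channel_sum1 ac : \sum_y W ac y = 1. Proof. by case: (hW ac). Qed.

Lemma output_ge0 c y : 0 <= output W c y.
Proof.
by rewrite divr_ge0 ?side_law_ge0 ?sumr_ge0// => a _; rewrite mulr_ge0 ?channel_ge0.
Qed.

Lemma output_gt0 ac y : 0 < p ac -> 0 < W ac y -> 0 < output W ac.2 y.
Proof.
case: ac => a c pac Wac; rewrite divr_gt0 ?(side_law_gt0 pac)//=.
rewrite (bigD1 a)//= ltr_pwDl ?mulr_gt0 ?sumr_ge0// => a' _.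
by rewrite mulr_ge0 ?channel_ge0.
Qed.

Lemma output_sum1 c : 0 < side_law c -> \sum_y output W c y = 1.
Proof.
move=> c0; rewrite -mulr_suml exchange_big/=.
under eq_bigr do rewrite -mulr_sumr channel_sum1 mulr1.
by rewrite divff ?gt_eqF.
Qed.

Lemma mean_const m : mean W (fun _ _ => m) = m.
Proof.
rewrite /mean; under eq_bigr do rewrite -mulr_suml channel_sum1 mul1r.
by rewrite -mulr_suml p_sum1 mul1r.
Qed.

(** Only the support is compared, so logarithms can be handled where their arguments are
    positive. *)
Lemma ler_mean phi psi :
  (forall ac y, 0 < p ac -> 0 < W ac y -> phi ac y <= psi ac y) ->
  mean W phi <= mean W psi.
Proof.
move=> H; apply: ler_sum => ac _.
have [->|p0] := eqVneq (p ac) 0; first by rewrite !mul0r.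
rewrite ler_wpM2l//; apply: ler_sum => y _.
have [->|W0] := eqVneq (W ac y) 0; first by rewrite !mul0r.
by rewrite ler_wpM2l ?channel_ge0// H// lt_def ?p0 ?W0 ?p_ge0 ?channel_ge0.
Qed.

Lemma cond_mutual_infoE b :
  cond_mutual_info b (joint p W) = mutual_info W / ln b.
Proof.
rewrite /cond_mutual_info /mutual_info /mean mulr_suml.
rewrite pair_bigA/=; apply: eq_bigr => -[a c] _ /=.
rewrite -[RHS]mulrA [X in _ = _ * X]mulr_suml [RHS]mulr_sumr; apply: eq_bigr => y _.
have jE a' y' : joint p W (a', c, y') = p (a', c) * W (a', c) y' by rewrite ffunE.
rewrite jE; under eq_bigr do under eq_bigr do rewrite jE.
under eq_bigr do rewrite -mulr_sumr channel_sum1 mulr1.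
under [X in _ / ((X / _) * _)]eq_bigr do rewrite jE.
rewrite -mulr_sumr channel_sum1 mulr1.
under [X in _ / (_ * (X / _))]eq_bigr do rewrite jE.
have [->|p0] := eqVneq (p (a, c)) 0; first by rewrite !mul0r.
have c0 : side_law c != 0.
  by apply: contra_neq p0 => /(@side_law_eq0 (a, c)).
rewrite -!/(side_law c) -/(output W c y) /logb /info_density /=.
(* The mass of (a, c) cancels between the joint law and its marginal. *)
have -> : p (a, c) * W (a, c) y / side_law c / (p (a, c) / side_law c * output W c y)
    = W (a, c) y / output W c y.
  by rewrite invfM; set o := (output W c y)^-1; field; rewrite p0 c0.
by rewrite !mulrA.
Qed.

End Channel.
End Information.

(** * Converse *)

Lemma ln_prod {R : realType} (I : finType) (f : I -> R) :
  (forall i, 0 < f i) -> ln (\prod_i f i) = \sum_i ln (f i).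
Proof.
move=> f0; rewrite -[RHS]expRK expR_sum; congr ln.
by apply: eq_bigr => i _; rewrite lnK ?posrE.
Qed.

Lemma ln_le_sub1 {R : realType} (x : R) : 0 < x -> ln x <= x - 1.
Proof.
by move=> x0; have := @le_ln1Dx R (x - 1); rewrite [1 + _]addrC subrK; apply; lra.
Qed.

Section Converse.
Context {R : realType} {A C B : finType}.
Variable p : {ffun A * C -> R}.
Hypothesis hp : is_pmf p.

Let p_ge0 ac : 0 <= p ac. Proof. by case: hp. Qed.
Let p_sum1 : \sum_ac p ac = 1. Proof. by case: hp. Qed.

(** * The time-averaged test channel of a code *)

Section Average.
Variables (n : nat) (r : {ffun 'I_n -> A * C} -> {ffun 'I_n -> B}).

(* W(y|a,c) is the average over i of P(r(w)_i = y | w_i = (a,c)); as the letters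
   are independent, the conditioning just drops the i-th factor, so that no
   division by p(a,c) occurs. *)
Definition average_channel (ac : A * C) : {ffun B -> R} :=
  [ffun y => n%:R^-1 * \sum_i \sum_(w : {ffun 'I_n -> A * C} |
    (w i == ac) && (r w i == y)) \prod_(k | k != i) p (w k)].

(** Words are grouped by the pair [(w i, r w i)]; the weight [p ac] in the mean restores the i-th
    factor that the channel omits. *)
Lemma mean_average phi : mean p average_channel phi =
  n%:R^-1 * \sum_i \sum_(w : {ffun _ -> _}) (\prod_k p (w k)) * phi (w i) (r w i).
Proof.
pose S i (z : A * C * B) := \sum_(w : {ffun 'I_n -> A * C} |
    (w i == z.1) && (r w i == z.2)) \prod_(k | k != i) p (w k).
transitivity (\sum_(z : A * C * B) n%:R^-1 * \sum_i p z.1 * S i z * phi z.1 z.2).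
  rewrite /mean; under eq_bigr do rewrite mulr_sumr.
  rewrite pair_bigA/=; apply: eq_bigr => z _; rewrite ffunE -mulr_suml -mulr_sumr.
  by rewrite /S; ring.
rewrite -mulr_sumr exchange_big/=; congr (_ * _); apply: eq_bigr => i _.
rewrite [RHS](partition_big (fun w : {ffun 'I_n -> A * C} => (w i, r w i)) predT)//=.
apply: eq_bigr => -[ac y] _; rewrite /S/= mulr_sumr mulr_suml.
apply: eq_big => [w|w /andP[/eqP <- /eqP <-]]; first by rewrite xpair_eqE.
by rewrite [in RHS](bigD1 i).
Qed.

Hypothesis n_gt0 : (0 < n)%N.

Lemma average_channelP : channel average_channel.
Proof.
move=> ac; split.
  move=> y; rewrite ffunE mulr_ge0 ?invr_ge0// sumr_ge0// => i _.
  by rewrite sumr_ge0// => w _; rewrite prodr_ge0.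
under eq_bigr do rewrite ffunE.
rewrite -mulr_sumr exchange_big/=.
suff H i : \sum_y \sum_(w : {ffun 'I_n -> A * C} | (w i == ac) && (r w i == y))
    \prod_(k | k != i) p (w k) = 1.
  under eq_bigr do rewrite H.
  by rewrite sumr_const card_ord mulVf// pnatr_eq0 -lt0n.
rewrite -(partition_big (fun w : {ffun 'I_n -> A * C} => r w i) predT)//=.
(* The constraint at [i] becomes an indicator in the i-th factor, and every factor then sums to
   1. *)
transitivity (\sum_(w : {ffun 'I_n -> A * C})
    \prod_k (if k == i then (w k == ac)%:R else p (w k))).
  rewrite big_mkcond/=; apply: eq_bigr => w _; rewrite [in RHS](bigD1 i)//= eqxx.
  case: eqP => _; rewrite ?mul0r// mul1r.
  by apply: eq_bigr => k /negbTE ->.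
rewrite (sum_prod_ffun (fun k t => if k == i then (t == ac)%:R else p t)).
rewrite big1// => k _; case: (k == i) => //.
by rewrite (bigD1 ac)//= eqxx big1 ?addr0// => t /negbTE ->.
Qed.

(** The word [w] itself contributes a positive term. This licenses logarithms along the code in the
    converse. *)
Lemma average_channel_gt0 (w : {ffun 'I_n -> A * C}) i : 0 < \prod_k p (w k) ->
  0 < average_channel (w i) (r w i).
Proof.
move=> Pw; rewrite ffunE mulr_gt0 ?invr_gt0 ?ltr0n//.
rewrite (bigD1 i)//= ltr_pwDl//; last first.
  by rewrite sumr_ge0// => j _; rewrite sumr_ge0// => v _; rewrite prodr_ge0.
rewrite (bigD1 w)/= ?eqxx// ltr_pwDl ?sumr_ge0//; last first.
  by move=> v _; rewrite prodr_ge0.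
rewrite lt_def prodr_ge0// andbT; apply/prodf_neq0 => k _.
by move: Pw; rewrite lt_def => /andP[/prodf_neq0 H _]; exact: H.
Qed.

End Average.

(** As [y] depends on the side information alone, the sum over the source word factorises by
    letters. Each factor is the side law times output/output, which is 1, or 0 where the output law
    vanishes; hence an inequality. *)
Lemma likelihood_sum_le1 (W : A * C -> {ffun B -> R}) (hW : channel W) n
    (y : {ffun 'I_n -> C} -> {ffun 'I_n -> B}) :
  \sum_(cn : {ffun 'I_n -> C}) \sum_(an : {ffun 'I_n -> A}) \prod_i (p (an i, cn i) *
    (W (an i, cn i) (y cn i) / output p W (cn i) (y cn i))) <= 1.
Proof.
rewrite -[leRHS](@iid_pmf _ _ 'I_n _ (side_law_sum1 hp)).
apply: ler_sum => cn _.
rewrite (sum_prod_ffun (fun i a => p (a, cn i) *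
    (W (a, cn i) (y cn i) / output p W (cn i) (y cn i)))).
apply: ler_prod => i _; rewrite sumr_ge0/=; last first.
  move=> a _; rewrite mulr_ge0// divr_ge0 ?channel_ge0//.
  exact: output_ge0.
under eq_bigr do rewrite mulrA.
rewrite -mulr_suml -outputM// -mulrA.
have [->|o0] := eqVneq (output p W (cn i) (y cn i)) 0.
  by rewrite mul0r mulr0 side_law_ge0.
by rewrite divff// mulr1.
Qed.

Lemma reconstruction_pair n M (k : @Defs.code A C B n M)
    (an : {ffun 'I_n -> A}) (cn : {ffun 'I_n -> C}) :
  reconstruction k [ffun i => (an i, cn i)] = Defs.decode k (encode k an cn) cn.
Proof.
rewrite /reconstruction; set an' := (X in encode k X _); set cn' := [ffun _ => _.2].
have -> : an' = an by apply/ffunP => i; rewrite !ffunE.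
by have -> : cn' = cn by apply/ffunP => i; rewrite !ffunE.
Qed.

(* By Jensen, the expected log-likelihood ratio of the average channel along the
   code is at most the log of the expected ratio; bounding the ratio at the
   chosen index by its sum over all M indices makes that expectation at most M. *)
Lemma converse_bound n M (k : @Defs.code A C B n M) : (0 < n)%N ->
  n%:R * mutual_info p (average_channel (reconstruction k)) <= ln M%:R.
Proof.
move=> n0; set r := reconstruction k; set W := average_channel r.
have hW : channel W by exact: average_channelP.
(* The encoder takes a value in ['I_M] on some constant word, so M is positive. *)
have M0 : 0 < M%:R :> R.
  have [[a c] _] := pmf_exists_gt0 hp.
  by rewrite ltr0n; case: (encode k [ffun=> a] [ffun=> c]) => m; exact: leq_ltn_trans.
have nR : n%:R != 0 :> R by rewrite pnatr_eq0 -lt0n.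
rewrite /mutual_info mean_average mulrA divff// mul1r exchange_big/=.
pose Z (w : {ffun 'I_n -> A * C}) := \prod_i (W (w i) (r w i) / output p W (w i).2 (r w i)).
have EZ : \sum_(w : {ffun 'I_n -> A * C}) (\prod_i p (w i)) * Z w <= M%:R.
  rewrite sum_ffun_pair.
  pose g (m : 'I_M) (cn : {ffun 'I_n -> C}) (an : {ffun 'I_n -> A}) :=
     \prod_i (p (an i, cn i) * (W (an i, cn i) (Defs.decode k m cn i) /
        output p W (cn i) (Defs.decode k m cn i))).
  have g0 m cn an : 0 <= g m cn an.
    rewrite prodr_ge0// => i _; rewrite mulr_ge0// divr_ge0 ?channel_ge0//.
    exact: output_ge0.
  apply: (@le_trans _ _ (\sum_cn \sum_an \sum_m g m cn an)).
    apply: ler_sum => cn _; apply: ler_sum => an _.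
    rewrite -big_split/= [leRHS](bigD1 (encode k an cn))//=.
    rewrite [leLHS](_ : _ = g (encode k an cn) cn an); first by rewrite lerDl sumr_ge0.
    rewrite /g /r reconstruction_pair.
    by apply: eq_bigr => i _; rewrite !ffunE.
  under eq_bigr do rewrite exchange_big/=.
  rewrite exchange_big/= [leRHS](_ : _ = \sum_(m < M) 1); last first.
    by rewrite sumr_const card_ord.
  apply: ler_sum => m _.
  exact: (likelihood_sum_le1 hW (Defs.decode k m)).
(* Jensen's inequality enters pointwise, as the tangent bound ln(Z/M) <= Z/M - 1 weighted by the
   probability of the word. *)
have hJ (w : {ffun 'I_n -> A * C}) :
   \sum_i (\prod_k p (w k)) * info_density p W (w i) (r w i) <=
   (\prod_k p (w k)) * (ln M%:R - 1) + (\prod_k p (w k)) * Z w / M%:R.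
  rewrite -mulr_sumr -mulrA -mulrDr.
  have [->|Pw] := eqVneq (\prod_k p (w k)) 0; first by rewrite !mul0r.
  have {}Pw : 0 < \prod_k p (w k) by rewrite lt_def Pw prodr_ge0.
  have p_gt0 i : 0 < p (w i).
    rewrite lt_def p_ge0 andbT.
    by move: Pw; rewrite lt_def => /andP[/prodf_neq0 H _]; exact: H.
  have W_gt0 i : 0 < W (w i) (r w i) by exact: average_channel_gt0.
  have f_gt0 i : 0 < W (w i) (r w i) / output p W (w i).2 (r w i).
    by rewrite divr_gt0// output_gt0.
  rewrite ler_wpM2l ?(ltW Pw)// -ln_prod// -/(Z w).
  have Z0 : 0 < Z w by rewrite prodr_gt0.
  have := ln_le_sub1 (divr_gt0 Z0 M0).
  by rewrite ln_div ?posrE//; lra.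
apply: le_trans (ler_sum _ (fun w _ => hJ w)) _.
rewrite big_split/= -!mulr_suml iid_pmf// mul1r.
have : (\sum_(w : {ffun 'I_n -> A * C}) (\prod_i p (w i)) * Z w) / M%:R <= 1.
  by rewrite ler_pdivrMr// mul1r.
lra.
Qed.

End Converse.

(** * Limits of channels *)

Section Limits.
Context {R : realType} {T : topologicalType} (F : set_system T).

(** Compactness of the segment gives a cluster point. The ultrafilter contains the preimage of each
    of its neighbourhoods or the complement, and the latter would contradict clustering. *)
Lemma ultra_bounded_cvg (f : T -> R) (a b : R) :
  UltraFilter F -> (forall t, a <= f t <= b) -> exists l : R, f t @[t --> F] --> l.
Proof.
move=> FU fab; have FF : ProperFilter F by exact: ultra_proper.
have [|l [_ fl]] := @segment_compact R a b (f t @[t --> F]) _.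
  by apply: (@filterS _ F _ setT); [move=> t _; rewrite /= in_itv/= fab|exact: filterT].
exists l => U lU; have [//|nU] := in_ultra_setVsetC (f @^-1` U) FU.
by have [x [nUx Ux]] := fl (~` U) U nU lU.
Qed.

Lemma cvg_finsum (I : finType) (f : T -> I -> R) (l : I -> R) : Filter F ->
  (forall i, f t i @[t --> F] --> l i) ->
  (\sum_i f t i) @[t --> F] --> \sum_i l i.
Proof. by move=> FF fl; apply: cvg_big => //; exact: add_continuous. Qed.

(** With s the square root of x, x ln x = -2 s (s ln(1/s)), and s ln(1/s) <= 1 - s. It serves as the
    lower side of a squeeze at 0. *)
Lemma xlnx_ge_sqrt (x : R) : 0 <= x -> - 2 * Num.sqrt x <= x * ln x.
Proof.
rewrite le_eqVlt => /predU1P[<-|x0]; first by rewrite sqrtr0 mulr0 mul0r.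
have s0 : 0 < Num.sqrt x by rewrite sqrtr_gt0.
rewrite -[X in X * ln _](sqr_sqrtr (ltW x0)) -[X in _ * ln X](sqr_sqrtr (ltW x0)).
move: s0; set s := Num.sqrt x => s0.
rewrite lnXn// -mulr_natl expr2 -mulrA mulrC.
have : s * ln (s^-1) <= 1.
  have := ln_le_sub1 (x := s^-1); rewrite invr_gt0 => /(_ s0) /(ler_wpM2l (ltW s0)).
  by rewrite mulrBr mulr1 divff ?gt_eqF// => H; lra.
rewrite lnV ?posrE// => H; nra.
Qed.

Lemma cvg_xlnx (f : T -> R) (l : R) : ProperFilter F -> (forall t, 0 <= f t) ->
  f t @[t --> F] --> l -> (f t * ln (f t)) @[t --> F] --> l * ln l.
Proof.
move=> FF f0 fl; have : 0 <= l.
  by apply: (ler_cvg_to (cvg_cst (0 : R)) fl); exact: nearW.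
rewrite le_eqVlt => /predU1P[l0|l0]; last first.
  by apply: cvgM => //; apply: cvg_comp fl _; exact: continuous_ln.
rewrite -l0 mul0r in fl *.
(* At the limit 0, x ln x lies between -2 sqrt(x) and x^2, the latter because ln x <= x. *)
apply: (squeeze_cvgr (f := fun t => - 2 * Num.sqrt (f t)) (h := fun t => f t * f t)).
- apply: nearW => t; rewrite xlnx_ge_sqrt//= ler_wpM2l//.
  have [->|ft0] := eqVneq (f t) 0; first by rewrite ln0.
  have := @ln_le_sub1 _ (f t); rewrite lt_def ft0 f0 => /(_ isT); lra.
- suff : (- 2 * Num.sqrt (f t)) @[t --> F] --> - 2 * Num.sqrt 0 by rewrite sqrtr0 mulr0.
  by apply: cvgM; [exact: cvg_cst|apply: cvg_comp fl _; exact: sqrt_continuous].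
- by rewrite -[X in _ --> X](mulr0 0); exact: cvgM.
Qed.

End Limits.

(** * Continuity of the mutual information and limits of test channels *)

Section Compactness.
Context {R : realType} {A C B : finType}.
Variable p : {ffun A * C -> R}.
Hypothesis hp : is_pmf p.

Lemma eq_mean (W : A * C -> {ffun B -> R}) phi psi : channel W ->
  (forall ac y, 0 < p ac -> 0 < W ac y -> phi ac y = psi ac y) ->
  mean p W phi = mean p W psi.
Proof.
by move=> hW H; apply/eqP; rewrite eq_le !ler_mean// => ac y p0 W0; rewrite H.
Qed.

(** In this form every term is some x ln x, continuous up to 0, whereas the logarithm of the ratio
    is not. *)
Lemma mutual_info_xlnx (W : A * C -> {ffun B -> R}) : channel W ->
  mutual_info p W =
  \sum_ac p ac * (\sum_y W ac y * ln (W ac y)) -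
  \sum_c side_law p c * (\sum_y output p W c y * ln (output p W c y)).
Proof.
move=> hW.
rewrite -(mean_output hp W (fun c y => ln (output p W c y))).
rewrite -[X in X - _]/(mean p W (fun ac y => ln (W ac y))).
transitivity (mean p W (fun ac y => ln (W ac y) - ln (output p W ac.2 y))).
  apply: eq_mean => // ac y p0 W0.
  by rewrite /info_density ln_div// posrE//; exact: output_gt0.
rewrite /mean -sumrB; apply: eq_bigr => ac _; rewrite -mulrBr -sumrB.
by congr (_ * _); apply: eq_bigr => y _; rewrite mulrBr.
Qed.

Lemma cvg_mutual_info (T : topologicalType) (F : set_system T)
    (W : T -> A * C -> {ffun B -> R}) (V : A * C -> {ffun B -> R}) :
  ProperFilter F -> (forall t, channel (W t)) -> channel V ->
  (forall ac y, W t ac y @[t --> F] --> V ac y) ->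
  mutual_info p (W t) @[t --> F] --> mutual_info p V.
Proof.
move=> FF hW hV WV; rewrite mutual_info_xlnx//.
under eq_cvg do rewrite mutual_info_xlnx//.
apply: cvgB; apply: cvg_finsum => i; apply: cvgM; (try exact: cvg_cst);
    apply: cvg_finsum => y; apply: cvg_xlnx => //.
- by move=> t; exact: channel_ge0.
- by move=> t; exact: output_ge0.
- rewrite /output; apply: cvgM; last exact: cvg_cst.
  by apply: cvg_finsum => a; apply: cvgM => //; exact: cvg_cst.
Qed.

Lemma cvg_mean (T : topologicalType) (F : set_system T)
    (W : T -> A * C -> {ffun B -> R}) (V : A * C -> {ffun B -> R}) phi :
  ProperFilter F -> (forall ac y, W t ac y @[t --> F] --> V ac y) ->
  mean p (W t) phi @[t --> F] --> mean p V phi.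
Proof.
move=> FF WV; apply: cvg_finsum => ac; apply: cvgM; first exact: cvg_cst.
by apply: cvg_finsum => y; apply: cvgM => //; exact: cvg_cst.
Qed.

Lemma channel_closure (W : nat -> A * C -> {ffun B -> R}) phi r D :
  (forall j, channel (W j)) ->
  (forall j, mutual_info p (W j) <= r + j.+1%:R^-1) ->
  (forall j, mean p (W j) phi <= D + j.+1%:R^-1) ->
  exists V, [/\ channel V, mutual_info p V <= r & mean p V phi <= D].
Proof.
move=> hW hI hD.
(* One ultrafilter finer than eventuality makes all entries of the channels converge at once,
   without extracting subsequences. *)
have [F [FU Foo]] := ultraFilterLemma (eventually_filter).
have FF : ProperFilter F by exact: ultra_proper.
have W01 ac y j : 0 <= W j ac y <= 1.
  rewrite channel_ge0//= -(channel_sum1 (hW j) ac) (bigD1 y)//= lerDl sumr_ge0// => z _.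
  exact: channel_ge0.
have /choice[V0 hV0] : forall z : A * C * B, exists l : R, W j z.1 z.2 @[j --> F] --> l.
  by move=> z; apply: (@ultra_bounded_cvg _ _ _ _ 0 1).
pose V ac := [ffun y => V0 (ac, y)].
have WV ac y : W j ac y @[j --> F] --> V ac y.
  by rewrite ffunE; exact: (hV0 (ac, y)).
have hV : channel V.
  move=> ac; split => [y|].
    apply: (ler_cvg_to (cvg_cst (0 : R)) (WV ac y)).
    by apply: nearW => j; exact: channel_ge0.
  have H : \sum_y W j ac y @[j --> F] --> \sum_y V ac y by exact: cvg_finsum.
  have H1 : (fun j => \sum_y W j ac y) = fun=> 1.
    by apply/funext => j; exact: channel_sum1.
  by rewrite H1 in H; apply: (cvg_unique _ H); [exact: norm_hausdorff|exact: cvg_cst].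
have e0 x : x + j.+1%:R^-1 @[j --> F] --> (x : R).
  rewrite -[X in _ --> X]addr0; apply: cvgD; first exact: cvg_cst.
  by apply: cvg_trans (@cvg_harmonic R) => U; exact: Foo.
exists V; split=> //.
- apply: (ler_cvg_to (cvg_mutual_info FF hW hV WV) (e0 r)).
  exact: nearW.
- apply: (ler_cvg_to (cvg_mean (phi := phi) FF WV) (e0 D)).
  exact: nearW.
Qed.

End Compactness.

(** * Random coding *)

(** Here [x] is the probability of being typical, [q] that of one codeword hitting, and [a] the
    change-of-measure factor. The left side is at most exp(-s x) <= 1/(1 + s x) with s = M a. *)
Lemma miss_bound {R : realType} (M : nat) (a x q : R) :
  0 <= x <= 1 -> 0 < a -> a * x <= q <= 1 ->
  (1 - q) ^+ M <= 1 - x + (1 + M%:R * a)^-1.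
Proof.
move=> /andP[x0 x1] a0 /andP[axq q1].
set s := M%:R * a; have s0 : 0 <= s by rewrite mulr_ge0 ?(ltW a0).
have sx0 : 0 <= s * x by rewrite mulr_ge0.
have ax0 : 0 <= a * x by rewrite mulr_ge0 ?(ltW a0).
apply: (@le_trans _ _ (1 + s * x)^-1).
  apply: (@le_trans _ _ (expR (- (a * x)) ^+ M)).
    rewrite lerXn2r ?nnegrE ?subr_ge0 ?expR_ge0//.
    by apply: le_trans (expR_ge1Dx _); lra.
  rewrite -expRM_natl mulrN expRN lef_pV2 ?posrE ?expR_gt0 ?ltr_pwDl//.
  by rewrite /s -mulrA expR_ge1Dx.
set u := (1 + s)^-1.
have u0 : 0 <= u by rewrite invr_ge0 addr_ge0.
have us : u * s = 1 - u.
  have : u * (1 + s) = 1 by rewrite /u mulVf// gt_eqF// ltr_pwDl.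
  lra.
have sx1 : 0 < 1 + s * x by rewrite ltr_pwDl.
rewrite -[leLHS]mul1r ler_pdivrMr//.
(* The product exceeds 1 by s x (1 - x) + u (1 - x), which is nonnegative. *)
rewrite [leRHS](_ : _ = 1 + s * x * (1 - x) + (u + (u * s) * x - x)); last by ring.
rewrite us.
have : 0 <= s * x * (1 - x) by rewrite mulr_ge0 ?subr_ge0.
have : 0 <= u * (1 - x) by rewrite mulr_ge0 ?subr_ge0.
lra.
Qed.

Section Achievability.
Context {R : realType} {A C B : finType}.
Variable p : {ffun A * C -> R}.
Hypothesis hp : is_pmf p.
Variables (W : A * C -> {ffun B -> R}) (phi : A * C -> B -> R).
Hypothesis hW : channel W.

Let p_ge0 ac : 0 <= p ac. Proof. by case: hp. Qed.
Let p_sum1 : \sum_ac p ac = 1. Proof. by case: hp. Qed.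

Lemma sum_joint (f : A * C -> B -> R) :
  \sum_t joint p W t * f t.1 t.2 = mean p W f.
Proof.
rewrite /mean; under [RHS]eq_bigr do rewrite mulr_sumr.
by rewrite pair_bigA; apply: eq_bigr => t _; rewrite ffunE mulrA.
Qed.

Lemma joint_ge0 t : 0 <= joint p W t.
Proof. by rewrite ffunE mulr_ge0 ?channel_ge0. Qed.

Lemma joint_sum1 : \sum_t joint p W t = 1.
Proof.
rewrite -(mean_const hp hW 1) -sum_joint; under [RHS]eq_bigr do rewrite mulr1.
by [].
Qed.

Let I := mutual_info p W.
Let De := mean p W phi.

(** The variances of information density and distortion, added so that one constant controls both
    deviations. *)
Definition dispersion : R :=
  \sum_t joint p W t * (info_density p W t.1 t.2 - I) ^+ 2 +
  \sum_t joint p W t * (phi t.1 t.2 - De) ^+ 2.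

(** A crude bound on how far one letter's distortion can exceed [De] when no codeword fits. *)
Definition excess_bound : R := (\sum_ac \sum_y `|phi ac y|) + `|De|.

Lemma dispersion_ge0 : 0 <= dispersion.
Proof.
by rewrite addr_ge0// sumr_ge0// => t _; rewrite mulr_ge0 ?joint_ge0 ?sqr_ge0.
Qed.

Lemma excess_bound_ge0 : 0 <= excess_bound.
Proof.
by rewrite addr_ge0// sumr_ge0// => ac _; rewrite sumr_ge0.
Qed.

Lemma le_excess_bound ac y : phi ac y <= De + excess_bound.
Proof.
have : `|phi ac y| <= \sum_ac \sum_y `|phi ac y|.
  rewrite (bigD1 ac)//= (bigD1 y)//= -addrA lerDl addr_ge0// sumr_ge0// => z _.
  by rewrite sumr_ge0.
have := ler_norm (phi ac y); have := ler_norm (- De); rewrite normrN.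
rewrite /excess_bound; lra.
Qed.

Variables (n M : nat) (c : R).
Hypotheses (n_gt0 : (0 < n)%N) (M_gt0 : (0 < M)%N) (c_gt0 : 0 < c).

Implicit Types (w : {ffun 'I_n -> A * C}) (y : {ffun 'I_n -> B}).

Let Pn w : R := \prod_i p (w i).
Let Wn w y : R := \prod_i W (w i) (y i).
Let qn (cn : {ffun 'I_n -> C}) y : R := \prod_i output p W (cn i) (y i).
Let snd w : {ffun 'I_n -> C} := [ffun i => (w i).2].

Let Pn_ge0 w : 0 <= Pn w. Proof. exact: prodr_ge0. Qed.
Let Wn_ge0 w y : 0 <= Wn w y.
Proof. by apply: prodr_ge0 => i _; exact: channel_ge0. Qed.
Let qn_ge0 cn y : 0 <= qn cn y.
Proof. by apply: prodr_ge0 => i _; exact: output_ge0. Qed.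
Let Wn_sum1 w : \sum_y Wn w y = 1.
Proof.
rewrite (sum_prod_ffun (fun i b => W (w i) b)) big1// => i _.
exact: channel_sum1.
Qed.

(** Typicality is one-sided: the change of measure and the distortion bound use upper bounds
    only. *)
Let good w y : bool :=
  ~~ (n%:R * (I + c) < \sum_i info_density p W (w i) (y i)) &&
  ~~ (n%:R * (De + c) < \sum_i phi (w i) (y i)).

Lemma atypical_bound :
  \sum_w Pn w * \sum_y Wn w y * (~~ good w y)%:R <= dispersion / (n%:R * c ^+ 2).
Proof.
pose bad1 (t : {ffun 'I_n -> A * C * B}) : bool :=
  n%:R * (I + c) < \sum_i info_density p W (t i).1 (t i).2.
pose bad2 (t : {ffun 'I_n -> A * C * B}) : bool :=
  n%:R * (De + c) < \sum_i phi (t i).1 (t i).2.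
(* Union bound, with source and output words merged into one i.i.d. word of law [joint p W]. *)
apply: (@le_trans _ _ (\sum_(t : {ffun 'I_n -> A * C * B})
   (\prod_i joint p W (t i)) * ((bad1 t)%:R + (bad2 t)%:R))).
  rewrite [leRHS]sum_ffun_pair [leRHS]exchange_big/=; apply: ler_sum => w _.
  rewrite mulr_sumr; apply: ler_sum => y _; rewrite mulrA.
  have -> : \prod_(i < n) joint p W ([ffun i0 => (w i0, y i0)] i) = Pn w * Wn w y.
    by rewrite -big_split/=; apply: eq_bigr => i _; rewrite !ffunE.
  rewrite ler_wpM2l ?mulr_ge0//.
  have -> : bad1 [ffun i => (w i, y i)] =
      (n%:R * (I + c) < \sum_i info_density p W (w i) (y i)).
    by rewrite /bad1; under eq_bigr do rewrite ffunE.
  have -> : bad2 [ffun i => (w i, y i)] = (n%:R * (De + c) < \sum_i phi (w i) (y i)).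
    by rewrite /bad2; under eq_bigr do rewrite ffunE.
  rewrite /good negb_and !negbK.
  by case: (_ < _); case: (_ < _); rewrite /= ?addr0 ?add0r// lerDl.
under eq_bigr do rewrite mulrDr.
rewrite big_split/= mulrDl; apply: lerD.
- apply: (@iid_chebyshev _ _ _ (joint p W) (fun t => info_density p W t.1 t.2)) => //.
  + exact: joint_ge0.
  + exact: joint_sum1.
  + exact: sum_joint.
- apply: (@iid_chebyshev _ _ _ (joint p W) (fun t => phi t.1 t.2)) => //.
  + exact: joint_ge0.
  + exact: joint_sum1.
  + exact: sum_joint.
Qed.

(* Change of measure: on typical pairs, the channel law exceeds the output law by
   a factor at most exp(n(I + c)). *)
Lemma typical_hit w : 0 < Pn w ->
  expR (- (n%:R * (I + c))) * (\sum_y Wn w y * (good w y)%:R) <=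
  \sum_y qn (snd w) y * (good w y)%:R.
Proof.
move=> Pw; rewrite mulr_sumr; apply: ler_sum => y _.
have [/andP[]|] := boolP (good w y); last by rewrite !mulr0.
rewrite -leNgt => Hi _; rewrite !mulr1.
have [->|Wy] := eqVneq (Wn w y) 0; first by rewrite mulr0.
have p_gt0 i : 0 < p (w i).
  rewrite lt_def p_ge0 andbT.
  by move: Pw; rewrite lt_def => /andP[/prodf_neq0 H _]; exact: H.
have W_gt0 i : 0 < W (w i) (y i).
  rewrite lt_def channel_ge0// andbT.
  by move/prodf_neq0: Wy; exact.
have o_gt0 i : 0 < output p W (w i).2 (y i) by exact: output_gt0.
have q_gt0 : 0 < qn (snd w) y by apply: prodr_gt0 => i _; rewrite ffunE.
rewrite expRN mulrC ler_pdivrMr ?expR_gt0// -ler_pdivrMl// mulrC.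
apply: le_trans (_ : expR (\sum_i info_density p W (w i) (y i)) <= _); last by rewrite ler_expR.
rewrite expR_sum -prodf_div le_eqVlt; apply/orP; left; apply/eqP.
by apply: eq_bigr => i _; rewrite ffunE lnK// posrE divr_gt0.
Qed.

Let qn_sum1 (cn : {ffun 'I_n -> C}) : (forall i, 0 < side_law p (cn i)) -> \sum_y qn cn y = 1.
Proof.
move=> H; rewrite (sum_prod_ffun (fun i b => output p W (cn i) b)) big1// => i _.
exact: output_sum1.
Qed.

Let hit w : R := \sum_y qn (snd w) y * (good w y)%:R.
Let missed w (cb : {ffun 'I_M -> {ffun 'I_n -> B}}) : R :=
  \prod_m (~~ good w (cb m))%:R.

(** For independent codewords of law [qn cn], the mean of the miss indicator factorises into the
    M-th power, and some codebook does no worse than the mean. It may depend on [cn], which both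
    terminals know. *)
Lemma exists_codebook (cn : {ffun 'I_n -> C}) :
  exists cb : {ffun 'I_M -> {ffun 'I_n -> B}},
   \sum_(an : {ffun 'I_n -> A})
      Pn [ffun i => (an i, cn i)] * missed [ffun i => (an i, cn i)] cb <=
   \sum_(an : {ffun 'I_n -> A})
      Pn [ffun i => (an i, cn i)] * (1 - hit [ffun i => (an i, cn i)]) ^+ M.
Proof.
have [H|] := pselect (forall i, 0 < side_law p (cn i)); last first.
  (* If some letter of [cn] is null, [qn cn] is not a law, but all words over [cn] have probability
     0 and any codebook will do. *)
  move/existsNP => [i Hi].
  have s0 : side_law p (cn i) = 0.
    by apply/eqP; rewrite eq_le side_law_ge0// andbT leNgt; exact/negP.
  have P0 (an : {ffun 'I_n -> A}) : Pn [ffun i => (an i, cn i)] = 0.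
    rewrite /Pn (bigD1 i)//= ffunE.
    by rewrite (@side_law_eq0 _ _ _ _ hp (an i, cn i))// mul0r.
  have [ac _] := pmf_exists_gt0 hp.
  have [y _] := pmf_exists_gt0 (hW ac).
  by exists [ffun=> [ffun=> y]]; rewrite !big1// => an _; rewrite P0 mul0r.
apply: (@exists_le_average _ _ (fun cb : {ffun 'I_M -> {ffun 'I_n -> B}} =>
   \prod_m qn cn (cb m))).
- by move=> cb; exact: prodr_ge0.
- exact/iid_pmf/qn_sum1.
- under eq_bigr do rewrite mulr_sumr.
  rewrite exchange_big/=; apply: ler_sum => an _.
  set w := [ffun i => (an i, cn i)].
  under eq_bigr do rewrite mulrCA -big_split/=.
  rewrite -mulr_sumr ler_wpM2l//.
  rewrite (sum_prod_ffun (fun (m : 'I_M) y => qn cn y * (~~ good w y)%:R)).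
  rewrite prodr_const card_ord le_eqVlt; apply/orP; left; apply/eqP; congr (_ ^+ _).
  have sw : snd w = cn by apply/ffunP => i; rewrite !ffunE.
  rewrite /hit sw -[X in X - _](qn_sum1 H) -sumrB; apply: eq_bigr => y _.
  by case: good; rewrite ?mulr1 ?mulr0 ?subrr ?subr0.
Qed.

Lemma hit_le1 w : 0 < Pn w -> hit w <= 1.
Proof.
move=> Pw; rewrite -(@qn_sum1 (snd w)); last first.
  move=> i; rewrite ffunE; apply: side_law_gt0 => //.
  rewrite lt_def p_ge0 andbT.
  by move: Pw; rewrite lt_def => /andP[/prodf_neq0 H _]; exact: H.
apply: ler_sum => y _; case: good; rewrite ?mulr1 ?mulr0//.
Qed.

Lemma random_coding : exists k : @Defs.code A C B n M,
  n%:R^-1 * (\sum_i \sum_w Pn w * phi (w i) (reconstruction k w i)) <=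
  De + c + excess_bound *
    (dispersion / (n%:R * c ^+ 2) + (1 + M%:R * expR (- (n%:R * (I + c))))^-1).
Proof.
have nR : 0 < n%:R :> R by rewrite ltr0n.
have /choice[cb hcb] := exists_codebook.
pose enc (an : {ffun 'I_n -> A}) (cn : {ffun 'I_n -> C}) : 'I_M :=
  odflt (Ordinal M_gt0) [pick m | good [ffun i => (an i, cn i)] (cb cn m)].
pose k := Code enc (fun m cn => cb cn m).
exists k.
have miss : \sum_w Pn w * missed w (cb (snd w)) <=
    dispersion / (n%:R * c ^+ 2) + (1 + M%:R * expR (- (n%:R * (I + c))))^-1.
  apply: (@le_trans _ _ (\sum_w Pn w * (1 - hit w) ^+ M)).
    rewrite !sum_ffun_pair; apply: ler_sum => cn _; apply: le_trans (hcb cn).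
    rewrite le_eqVlt; apply/orP; left; apply/eqP; apply: eq_bigr => an _.
    by congr (_ * missed _ (cb _)); apply/ffunP => i; rewrite !ffunE.
  apply: (@le_trans _ _ (\sum_w Pn w *
      (\sum_y Wn w y * (~~ good w y)%:R + (1 + M%:R * expR (- (n%:R * (I + c))))^-1))).
    apply: ler_sum => w _.
    have [->|Pw] := eqVneq (Pn w) 0; first by rewrite !mul0r.
    have {}Pw : 0 < Pn w by rewrite lt_def Pw Pn_ge0.
    rewrite ler_wpM2l//.
    have -> : \sum_y Wn w y * (~~ good w y)%:R = 1 - \sum_y Wn w y * (good w y)%:R.
      rewrite -[X in X - _](Wn_sum1 w) -sumrB; apply: eq_bigr => y _.
      by case: good; rewrite ?mulr1 ?mulr0 ?subrr ?subr0.
    apply: miss_bound.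
    - rewrite sumr_ge0/=; last by move=> y _; rewrite mulr_ge0.
      rewrite -[leRHS](Wn_sum1 w); apply: ler_sum => y _.
      by case: good; rewrite ?mulr1 ?mulr0.
    - exact: expR_gt0.
    - by rewrite typical_hit// hit_le1.
  under eq_bigr do rewrite mulrDr.
  rewrite big_split/= -mulr_suml iid_pmf// mul1r lerD2r.
  exact: atypical_bound.
rewrite exchange_big/=.
apply: (@le_trans _ _ (n%:R^-1 * \sum_w Pn w *
    (n%:R * (De + c + excess_bound * missed w (cb (snd w)))))).
  rewrite ler_wpM2l ?invr_ge0// ?ler0n//; apply: ler_sum => w _.
  rewrite -mulr_sumr ler_wpM2l//.
  have wE : [ffun i => ([ffun i => (w i).1] i, snd w i)] = w.
    by apply/ffunP => i; rewrite !ffunE; case: (w i).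
  rewrite -/(snd w) /enc wE.
  case: pickP => [m|none] /=.
    move=> gm; have -> : missed w (cb (snd w)) = 0.
      by rewrite /missed (bigD1 m)//= gm mul0r.
    rewrite mulr0 addr0; move: gm; rewrite /good => /andP[_].
    by rewrite -leNgt.
  have -> : missed w (cb (snd w)) = 1.
    by rewrite /missed big1// => m _; rewrite none.
  rewrite mulr1 mulr_natl -[X in _ *+ X]card_ord -sumr_const; apply: ler_sum => i _.
  apply: le_trans (le_excess_bound _ _) _.
  by rewrite lerD2r lerDl ltW.
have -> : \sum_w Pn w * (n%:R * (De + c + excess_bound * missed w (cb (snd w)))) =
   n%:R * (De + c + excess_bound * \sum_w Pn w * missed w (cb (snd w))).
  transitivity (\sum_w (Pn w * (n%:R * (De + c)) +
      n%:R * excess_bound * (Pn w * missed w (cb (snd w))))).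
    by apply: eq_bigr => w _; ring.
  by rewrite big_split/= -mulr_suml iid_pmf// -mulr_sumr; ring.
rewrite mulrA mulVf ?gt_eqF// mul1r lerD2l ler_wpM2l//.
exact: excess_bound_ge0.
Qed.

End Achievability.

(** * Coding theorem *)

Lemma limn_esup_leP {R : realType} (u : nat -> \bar R) (l : R) :
  (limn_esup u <= l%:E)%E <->
  forall e : R, 0 < e -> \forall n \near \oo, (u n <= (l + e)%:E)%E.
Proof.
rewrite /limn_esup limf_esupE; split=> [H e e0|H].
  apply: contrapT => nH.
  suff : ((l + e)%:E <= l%:E)%E by rewrite lee_fin gerDl leNgt e0.
  apply: le_trans H; apply: le_ereal_inf_tmp => _ [V Voo <-].
  rewrite leNgt; apply/negP => sV; apply: nH.
  apply: filterS Voo => n Vn; apply/ltW/le_lt_trans/sV.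
  by apply: ereal_sup_ubound; exists n.
apply/lee_addgt0Pr => e e0; rewrite -EFinD.
apply: ge_ereal_inf; exists (ereal_sup [set u n | n in [set n | (u n <= (l + e)%:E)%E]]).
  by exists [set n | (u n <= (l + e)%:E)%E] => //; exact: H.
by apply: ge_ereal_sup => _ [n un <-].
Qed.

Lemma near_infty_inv_le {R : realType} (e : R) : 0 < e ->
  \forall n \near \oo, (0 < n)%N /\ n%:R^-1 <= e.
Proof.
move=> e0; near=> n.
have Hn : (Num.truncn e^-1 < n)%N by near: n; exact: nbhs_infty_gt.
have n0 : (0 < n)%N by exact: leq_ltn_trans Hn.
split=> //; rewrite invf_ple ?posrE ?ltr0n//.
by apply: le_trans (ltW (truncnS_gt _)) _; rewrite ler_nat.
Unshelve. all: by end_near. Qed.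

Section CodingTheorem.
Context {R : realType} {A C B : finType}.
Variables (p : {ffun A * C -> R}) (d : A * C -> B -> \bar R).
Variables (phi : A * C -> B -> R) (b : R).
Hypotheses (hp : is_pmf p) (d_phi : forall ac y, d ac y = (phi ac y)%:E).
Hypothesis b_gt1 : 1 < b.

Let lnb_gt0 : 0 < ln b. Proof. exact: ln_gt0. Qed.

(** By ln t <= t - 1 the mean is at most the averaged total of [f] minus 1, so a subprobability [f]
    suffices. It gives nonnegativity of information and its decrease under merging. *)
Lemma gibbs (W : A * C -> {ffun B -> R}) (f : A * C -> B -> R) : channel W ->
  (forall ac y, 0 < p ac -> 0 <= f ac y) ->
  (forall ac, 0 < p ac -> \sum_y f ac y <= 1) ->
  (forall ac y, 0 < p ac -> 0 < W ac y -> 0 < f ac y) ->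
  mean p W (fun ac y => ln (f ac y / W ac y)) <= 0.
Proof.
move=> hW f_ge0 f_le1 f_gt0.
apply: (@le_trans _ _ (mean p W (fun ac y => f ac y / W ac y - 1))).
  by apply: ler_mean => // ac y p0 W0; apply: ln_le_sub1; rewrite divr_gt0// f_gt0.
apply: sumr_le0 => ac _.
have [->|p0] := eqVneq (p ac) 0; first by rewrite mul0r.
have {}p0 : 0 < p ac by rewrite lt_def p0; case: hp => ->.
rewrite pmulr_rle0//.
under eq_bigr do rewrite mulrBr mulr1.
rewrite sumrB channel_sum1// subr_le0; apply: le_trans (f_le1 _ p0).
apply: ler_sum => y _; have [->|W0] := eqVneq (W ac y) 0; first by rewrite mul0r f_ge0.
by rewrite mulrC divfK.
Qed.

Lemma mutual_info_ge0 (W : A * C -> {ffun B -> R}) : channel W -> 0 <= mutual_info p W.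
Proof.
move=> hW; rewrite -oppr_le0.
have -> : - mutual_info p W = mean p W (fun ac y => ln (output p W ac.2 y / W ac y)).
  rewrite /mutual_info /mean -sumrN; apply: eq_bigr => ac _.
  have [->|p0] := eqVneq (p ac) 0; first by rewrite !mul0r oppr0.
  have {}p0 : 0 < p ac by rewrite lt_def p0; case: hp => ->.
  rewrite -mulrN -sumrN; congr (_ * _); apply: eq_bigr => y _.
  have [->|W0] := eqVneq (W ac y) 0; first by rewrite !mul0r oppr0.
  have {}W0 : 0 < W ac y by rewrite lt_def W0 channel_ge0.
  rewrite -mulrN /info_density; have o0 := output_gt0 hp hW p0 W0.
  by move: (output p W ac.2 y) o0 => o o0; rewrite !ln_div ?posrE// opprB.
apply: gibbs => //.
- by move=> ac y _; exact: output_ge0.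
- by move=> ac p0; rewrite output_sum1// side_law_gt0.
- by move=> ac y p0 W0; exact: output_gt0.
Qed.

Lemma avg_distortionE n M (k : @Defs.code A C B n M) :
  avg_distortion p d k = (n%:R^-1 *
   (\sum_i \sum_(w : {ffun 'I_n -> A * C})
     (\prod_j p (w j)) * phi (w i) (reconstruction k w i)))%:E.
Proof.
rewrite /avg_distortion EFinM -sumEFin; congr (_ * _)%E; apply: eq_bigr => i _.
rewrite /expect -sumEFin; apply: eq_bigr => w _.
by rewrite d_phi EFinM ffunE.
Qed.

Lemma feasible_channel_of_achievable D r : achievable p d b D r ->
  exists W : A * C -> {ffun B -> R},
    [/\ channel W, mutual_info p W <= r * ln b & mean p W phi <= D].
Proof.
move=> [M [k [/limn_esup_leP hr /limn_esup_leP hD]]].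
have /choice[W hW] : forall j : nat, exists W : A * C -> {ffun B -> R},
    [/\ channel W, mutual_info p W <= r * ln b + j.+1%:R^-1 &
        mean p W phi <= D + j.+1%:R^-1].
  move=> j; have j0 : 0 < j.+1%:R^-1 :> R by rewrite invr_gt0 ltr0n.
  have /filter_ex[n [n0 hrn hDn]] : \forall n \near \oo, [/\ (0 < n)%N,
     ((n%:R^-1 * logb b (M n)%:R)%:E <= (r + j.+1%:R^-1 / ln b)%:E)%E &
     (avg_distortion p d (k n) <= (D + j.+1%:R^-1)%:E)%E].
    (* The rate slack is divided by [ln b] so that it becomes 1/(j + 1) in nats. *)
    near=> n; split.
    - by near: n; exact: nbhs_infty_gt.
    - by near: n; apply: hr; rewrite divr_gt0.
    - by near: n; exact: hD.
  exists (average_channel p (reconstruction (k n))); split.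
  - exact: average_channelP.
  - have := converse_bound hp (k n) n0.
    move: hrn; rewrite lee_fin /logb mulrA ler_pdivrMr// mulrDl divfK ?gt_eqF// => hrn.
    by rewrite -ler_pdivlMl ?ltr0n// => /le_trans; apply.
  - by rewrite mean_average; move: hDn; rewrite avg_distortionE lee_fin.
by apply: (channel_closure hp (W := W)) => j; have [] := hW j.
Unshelve. all: by end_near. Qed.

Lemma achievable_of_feasible_channel (W : A * C -> {ffun B -> R}) D r :
  channel W -> mean p W phi <= D -> mutual_info p W < r * ln b ->
  achievable p d b D r.
Proof.
move=> hW hD hr; set rho := r * ln b; set I := mutual_info p W.
have rho0 : 0 <= rho by apply: le_trans (mutual_info_ge0 hW) (ltW hr).
(* Half the gap: since u <= 1, the exponent rho - I - g u stays at least g u. *)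
pose g := (rho - I) / 2; have g0 : 0 < g by rewrite divr_gt0// subr_gt0.
(* This is n^(-1/4). With tolerance g u the Chebyshev term is V u^2 / g^2 and the miss term at most
   u^3 / g, so all errors are at most [kappa * u n]. *)
pose u (n : nat) : R := Num.sqrt (Num.sqrt n%:R^-1).
pose V := dispersion p W phi; pose K := excess_bound p W phi.
pose kappa := g + K * (V / g ^+ 2 + g^-1).
have V0 : 0 <= V by exact: dispersion_ge0.
have K0 : 0 <= K by exact: excess_bound_ge0.
have kappa0 : 0 < kappa.
  by rewrite ltr_pwDl// mulr_ge0// addr_ge0 ?invr_ge0 ?(ltW g0)// divr_ge0 ?sqr_ge0.
pose M (n : nat) := (Num.truncn (expR (n%:R * rho))).+1.
have hk : forall n : nat, {k : @Defs.code A C B n (M n) |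
    (0 < n)%N -> (avg_distortion p d k <= (D + kappa * u n)%:E)%E}.
  move=> n; apply: cid; case: n => [|n'].
    (* Block length 0 gets an arbitrary constant code; it does not affect the limits. *)
    have [ac _] := pmf_exists_gt0 hp.
    have [y _] := pmf_exists_gt0 (hW ac).
    by exists (Code (fun _ _ => ord0) (fun _ _ => [ffun=> y])).
  set n := n'.+1; have n0 : 0 < n%:R :> R by rewrite ltr0n.
  have u0 : 0 < u n by rewrite !sqrtr_gt0 invr_gt0.
  have u4 : u n ^+ 4 = n%:R^-1.
    by rewrite (exprM _ 2 2) !sqr_sqrtr ?sqrtr_ge0 ?invr_ge0 ?(ltW n0).
  have u1 : u n <= 1.
    rewrite -[leRHS](sqrtr1) -[X in _ <= Num.sqrt X](sqrtr1) !ler_wsqrtr//.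
    by rewrite invf_le1// ler1n.
  have c0 : 0 < g * u n by rewrite mulr_gt0.
  have [//|//|//|k kP] := @random_coding _ _ _ _ _ hp W phi hW n (M n) (g * u n).
  exists k => _; rewrite avg_distortionE lee_fin; apply: le_trans kP _.
  rewrite -/I -/V -/K.
  have Mc : n%:R * (g * u n) <= 1 + (M n)%:R * expR (- (n%:R * (I + g * u n))).
    apply: (@le_trans _ _ (1 + expR (n%:R * rho) * expR (- (n%:R * (I + g * u n))))); last first.
      by rewrite lerD2l ler_wpM2r ?expR_ge0// ltW// truncnS_gt.
    rewrite -expRD -mulrBr -[leLHS]add0r lerD//.
    apply: le_trans (_ : n%:R * (rho - (I + g * u n)) <= _).
      rewrite ler_wpM2l ?(ltW n0)//.
      have : g * u n <= g by rewrite ler_piMr// ltW.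
      by rewrite /g; lra.
    by apply: le_trans (expR_ge1Dx _); rewrite lerDr.
  have h1 : (1 + (M n)%:R * expR (- (n%:R * (I + g * u n))))^-1 <= u n / g.
    apply: (@le_trans _ _ (n%:R * (g * u n))^-1).
      have nc0 : 0 < n%:R * (g * u n) by rewrite mulr_gt0.
      by rewrite lef_pV2 ?posrE// (lt_le_trans nc0 Mc).
    have -> : (n%:R * (g * u n))^-1 = u n / g * u n ^+ 2.
      by rewrite invfM -u4; field; rewrite !gt_eqF.
    by rewrite ler_piMr ?exprn_ile1 ?(ltW u0)// divr_ge0 ?ltW.
  have h2 : V / (n%:R * (g * u n) ^+ 2) <= V / g ^+ 2 * u n.
    have -> : V / (n%:R * (g * u n) ^+ 2) = V / g ^+ 2 * u n * u n.
      by rewrite invfM -u4; field; rewrite !gt_eqF.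
    by rewrite ler_piMr// mulr_ge0 ?(ltW u0)// divr_ge0 ?sqr_ge0.
  have -> : D + kappa * u n = (D + g * u n) + K * (V / g ^+ 2 * u n + u n / g).
    by rewrite /kappa; field; rewrite gt_eqF.
  by rewrite lerD ?lerD2r// ler_wpM2l// lerD.
exists M, (fun n => sval (hk n)); split; apply/limn_esup_leP => e e0.
- have : \forall n \near \oo, (0 < n)%N /\ n%:R^-1 <= e * ln b / ln 2.
    by apply: near_infty_inv_le; rewrite divr_gt0 ?mulr_gt0// ln_gt0// ltr1n.
  apply: filterS => n [n0 ne]; rewrite lee_fin /logb mulrA ler_pdivrMr//.
  rewrite ler_pdivrMl ?ltr0n//.
  have e1 : 1 <= expR (n%:R * rho) by rewrite -expR0 ler_expR mulr_ge0.
  (* Rounding at most doubles the codebook size, which costs ln 2 / n in rate. *)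
  apply: (@le_trans _ _ (ln (2 * expR (n%:R * rho)))).
    rewrite ler_ln ?posrE ?ltr0n ?mulr_gt0 ?expR_gt0//.
    have := @truncn_itv _ (expR (n%:R * rho)) (expR_ge0 _).
    by rewrite /M => /andP[h _]; rewrite -natr1; lra.
  rewrite lnM ?posrE ?expR_gt0// expRK mulrDl mulrDr -/rho addrC lerD2l.
  move: ne; rewrite ler_pdivlMr ?ln_gt0 ?ltr1n// mulrC ler_pdivrMr ?ltr0n//.
  by rewrite [n%:R * _]mulrC.
- have : \forall n \near \oo, (0 < n)%N /\ n%:R^-1 <= (e / kappa) ^+ 4.
    by apply: near_infty_inv_le; rewrite exprn_gt0// divr_gt0.
  apply: filterS => n [n0 ne]; apply: le_trans (svalP (hk n) n0) _.
  rewrite lee_fin lerD2l mulrC -ler_pdivlMr//.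
  have ek : 0 <= e / kappa by rewrite divr_ge0 ?ltW.
  rewrite -[leRHS]ger0_norm// -sqrtr_sqr ler_wsqrtr//.
  rewrite -[leRHS]ger0_norm ?sqr_ge0// -sqrtr_sqr ler_wsqrtr//.
  by rewrite -exprM.
Qed.

Lemma information_rateE D : information_rate p d b D =
  ereal_inf [set (mutual_info p W / ln b)%:E | W in
    [set W : A * C -> {ffun B -> R} | channel W /\ mean p W phi <= D]].
Proof.
have expE W : expect (joint p W) (fun t => d t.1 t.2) = (mean p W phi)%:E.
  rewrite -(expect_joint p W phi) /expect.
  by apply: eq_bigr => t _; rewrite d_phi.
congr ereal_inf; apply/seteqP; split=> x /= [W [hW hD] <-]; exists W.
- by split=> //; rewrite -lee_fin -expE.
- by rewrite cond_mutual_infoE.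
- by split=> //; rewrite expE lee_fin.
- by rewrite cond_mutual_infoE.
Qed.

(** Achievability needs a rate strictly above the information, hence a slack [e]; the converse
    reaches the rate [r] itself. *)
Theorem operational_rateE D : operational_rate p d b D = information_rate p d b D.
Proof.
rewrite information_rateE; apply/eqP; rewrite eq_le; apply/andP.
split; apply: le_ereal_inf_tmp => x /=.
- move=> [W [hW hD] <-]; apply/lee_addgt0Pr => e e0; rewrite -EFinD.
  apply: ereal_inf_lbound; exists (mutual_info p W / ln b + e) => //.
  apply: (achievable_of_feasible_channel hW hD).
  by rewrite mulrDl divfK ?gt_eqF// ltrDl mulr_gt0.
- move=> [r hr <-].
  have [W [hW hI hD]] := feasible_channel_of_achievable hr.
  apply: ge_ereal_inf; exists (mutual_info p W / ln b)%:E; first by exists W.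
  by rewrite lee_fin ler_pdivrMr.
Qed.

End CodingTheorem.

(** * Merging source letters *)

Section Merging.
Context {R : realType} {A S C B : finType}.
Variables (p : {ffun A * C -> R}) (sigma : A * C -> S) (p' : {ffun S * C -> R}).
Hypothesis hp : is_pmf p.
Hypothesis p'E : forall sc, p' sc = \sum_(a | sigma (a, sc.2) == sc.1) p (a, sc.2).

Implicit Types (W : A * C -> {ffun B -> R}) (U : S * C -> {ffun B -> R}).

Let p_ge0 ac : 0 <= p ac. Proof. by case: hp. Qed.

Definition merge (ac : A * C) : S * C := (sigma ac, ac.2).

Lemma sum_merge c (g : S -> R) :
  \sum_s p' (s, c) * g s = \sum_a p (a, c) * g (sigma (a, c)).
Proof.
rewrite [RHS](partition_big (fun a => sigma (a, c)) predT)//=.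
apply: eq_bigr => s _; rewrite p'E mulr_suml.
by apply: eq_bigr => a /eqP ->.
Qed.

Lemma merge_pmf : is_pmf p'.
Proof.
split=> [sc|]; first by rewrite p'E sumr_ge0.
case: hp => _ <-; rewrite (eq_bigr (fun sc => p' (sc.1, sc.2))); last by case.
rewrite [RHS](eq_bigr (fun ac => p (ac.1, ac.2))); last by case.
rewrite -(pair_bigA _ (fun s c => p' (s, c))) -(pair_bigA _ (fun a c => p (a, c)))/=.
rewrite exchange_big [RHS]exchange_big; apply: eq_bigr => c _.
have := sum_merge c (fun=> 1).
by rewrite -!mulr_suml !mulr1.
Qed.

Lemma side_law_merge c : side_law p' c = side_law p c.
Proof.
have := sum_merge c (fun=> 1); rewrite /side_law.
by rewrite -!mulr_suml !mulr1.
Qed.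

Lemma mean_merge U psi :
  mean p' U psi = mean p (U \o merge) (fun ac => psi (merge ac)).
Proof.
rewrite !mean_pair; apply: eq_bigr => c _; apply: eq_bigr => y _.
under eq_bigr do rewrite -mulrA.
rewrite (sum_merge c (fun s => U (s, c) y * psi (s, c) y)).
by apply: eq_bigr => a _; rewrite mulrA.
Qed.

(** The lifted channel is constant on fibres and has the same output law, so the information
    densities agree. *)
Lemma mutual_info_merge U : mutual_info p' U = mutual_info p (U \o merge).
Proof.
rewrite /mutual_info mean_merge; congr mean; apply/funext => -[a c]; apply/funext => y.
rewrite /info_density /merge /=; congr (ln (_ / _)).
by rewrite /output side_law_merge (sum_merge c (fun s => U (s, c) y)).
Qed.

(** * Averaging a channel over the fibres *)

Section Average.
Variable W : A * C -> {ffun B -> R}.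
Hypothesis hW : channel W.
Variable ac0 : A * C.

(** Null merged letters borrow the row of an arbitrary letter [ac0], so that every row is a law. *)
Definition merged_channel (sc : S * C) : {ffun B -> R} := [ffun y =>
  if p' sc == 0 then W ac0 y
  else (\sum_(a | sigma (a, sc.2) == sc.1) p (a, sc.2) * W (a, sc.2) y) / p' sc].

Lemma merged_channelP : channel merged_channel.
Proof.
move=> sc; split.
  move=> y; rewrite ffunE; case: ifP => _; first exact: channel_ge0.
  rewrite divr_ge0//; last by case: merge_pmf.
  by rewrite sumr_ge0// => a _; rewrite mulr_ge0// channel_ge0.
under eq_bigr do rewrite ffunE.
have [_|p0] := eqVneq (p' sc) 0; first exact: channel_sum1.
rewrite -mulr_suml exchange_big/=.
under eq_bigr do rewrite -mulr_sumr channel_sum1// mulr1.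
by rewrite -p'E divff.
Qed.

Lemma merged_channelE s c y : p' (s, c) * merged_channel (s, c) y =
  \sum_(a | sigma (a, c) == s) p (a, c) * W (a, c) y.
Proof.
rewrite ffunE/=; have [p0|p0] := eqVneq (p' (s, c)) 0; last by rewrite mulrC divfK.
rewrite p0 mul0r big1// => a /eqP sa.
move/eqP: p0; rewrite p'E psumr_eq0//= => /allP/(_ a).
by rewrite mem_index_enum sa eqxx => /(_ isT) /eqP ->; rewrite mul0r.
Qed.

Lemma sum_merged c y (g : S -> R) :
  \sum_s p' (s, c) * merged_channel (s, c) y * g s =
  \sum_a p (a, c) * W (a, c) y * g (sigma (a, c)).
Proof.
rewrite [RHS](partition_big (fun a => sigma (a, c)) predT)//=.
apply: eq_bigr => s _; rewrite merged_channelE mulr_suml.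
by apply: eq_bigr => a /eqP ->.
Qed.

Lemma mean_merged psi :
  mean p' merged_channel psi = mean p W (fun ac => psi (merge ac)).
Proof.
rewrite !mean_pair; apply: eq_bigr => c _; apply: eq_bigr => y _.
exact: (sum_merged c y (fun s => psi (s, c) y)).
Qed.

Lemma output_merged c y : output p' merged_channel c y = output p W c y.
Proof.
rewrite /output side_law_merge; congr (_ / _).
have := sum_merged c y (fun=> 1).
by rewrite -!mulr_suml !mulr1.
Qed.

(** Averaging preserves the output law, so the two informations differ by the mean of ln(V/W), which
    Gibbs' inequality makes nonpositive. *)
Lemma mutual_info_merged : mutual_info p' merged_channel <= mutual_info p W.
Proof.
rewrite {1}/mutual_info mean_merged.
pose V ac := merged_channel (merge ac).
have V_gt0 ac y : 0 < p ac -> 0 < W ac y -> 0 < V ac y.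
  case: ac => a c p0 W0; rewrite /V /merge/=.
  have pV : 0 < p' (sigma (a, c), c) * merged_channel (sigma (a, c), c) y.
    rewrite merged_channelE (bigD1 a)//= ltr_pwDl ?mulr_gt0// sumr_ge0// => a' _.
    by rewrite mulr_ge0 ?channel_ge0.
  rewrite lt_def channel_ge0 ?andbT; last exact: merged_channelP.
  by apply: contraTneq pV => ->; rewrite mulr0 ltxx.
have -> : mean p W (fun ac => info_density p' merged_channel (merge ac)) =
    mean p W (fun ac y => ln (V ac y / W ac y)) + mutual_info p W.
  rewrite /mutual_info.
  transitivity (mean p W (fun ac y => ln (V ac y / W ac y) + info_density p W ac y)).
    apply: eq_mean => // ac y p0 W0.
    rewrite /info_density output_merged /=.
    have := output_gt0 hp hW p0 W0; move: (output p W ac.2 y) => o o0.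
    by rewrite !ln_div ?posrE ?V_gt0// addrA subrK.
  rewrite /mean -big_split/=; apply: eq_bigr => ac _; rewrite -mulrDr -big_split/=.
  by congr (_ * _); apply: eq_bigr => y _; rewrite mulrDr.
rewrite gerDr; apply: gibbs => //.
- by move=> ac y _; exact: (channel_ge0 merged_channelP).
- by move=> ac _; rewrite (channel_sum1 merged_channelP).
Qed.

End Average.

Lemma information_rate_merge (d : A * C -> B -> \bar R) (d' : S * C -> B -> \bar R)
    (b D : R) : 1 < b ->
  (forall ac y, d ac y \is a fin_num) -> (forall sc y, d' sc y \is a fin_num) ->
  (forall ac y, 0 < p ac -> d ac y = d' (merge ac) y) ->
  information_rate p d b D = information_rate p' d' b D.
Proof.
move=> b1 dfin d'fin dd'.
rewrite (@information_rateE _ _ _ _ _ _ (fun ac y => fine (d ac y)))//; last first.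
  by move=> ac y; rewrite fineK.
rewrite (@information_rateE _ _ _ _ _ _ (fun ac y => fine (d' ac y)))//; last 2 first.
- exact: merge_pmf.
- by move=> ac y; rewrite fineK.
apply/eqP; rewrite eq_le; apply/andP; split; apply: le_ereal_inf_tmp => x /=.
- move=> [U [hU hD] <-]; rewrite mutual_info_merge.
  apply: ereal_inf_lbound; exists (U \o merge) => //; split; first by move=> ac; exact: hU.
  move: hD; rewrite mean_merge; congr (_ <= _); apply: (eq_mean hp).
  + by move=> ac; exact: hU.
  + by move=> ac y p0 _; rewrite dd'.
- move=> [W [hW hD] <-]; have [ac0 _] := pmf_exists_gt0 hp.
  apply: ge_ereal_inf; exists (mutual_info p' (merged_channel W ac0) / ln b)%:E.
    exists (merged_channel W ac0) => //; split; first exact: merged_channelP.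
    move: hD; rewrite mean_merged; congr (_ <= _); apply: eq_mean => // ac y p0 _.
    by rewrite dd'.
  by rewrite lee_fin ler_pM2r ?invr_gt0 ?ln_gt0//; exact: mutual_info_merged.
Qed.

End Merging.

(** * The two state problems *)

Section States.
Context {R : realType} {F X C : finType}.
Variable P : {ffun F * X * C -> R}.
Hypothesis hP : is_pmf P.

Let P_ge0 t : 0 <= P t. Proof. by case: hP. Qed.

Lemma law_XC_pmf : is_pmf (law_XC P).
Proof.
split=> [xc|]; first by rewrite ffunE sumr_ge0.
under eq_bigr do rewrite ffunE.
rewrite exchange_big pair_bigA /=.
case: hP => _ <-; rewrite (reindex (fun t : F * X * C => (t.1.1, (t.1.2, t.2))))/=.
  by apply: eq_bigr => -[[]].
by exists (fun t => (t.1, t.2.1, t.2.2)) => [[[]]|[? []]].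
Qed.

Lemma eta_states xc : 0 < law_XC P xc -> eta P xc \in states P.
Proof. by move=> xc0; apply/imfsetP; exists xc; rewrite //= inE. Qed.

Lemma eta_null xc : law_XC P xc = 0 -> eta P xc = [ffun=> 0].
Proof.
move=> xc0; apply/ffunP => f; rewrite !ffunE.
move/eqP: xc0; rewrite ffunE psumr_eq0// => /allP/(_ f).
by rewrite mem_index_enum => /(_ isT)/eqP ->; rewrite mul0r.
Qed.

(** At null pairs [eta] is the zero function, so this keeps the indirect distortion finite there. *)
Lemma divergence_null (L : {ffun F -> R} -> F -> \bar R) q :
  divergence L [ffun=> 0] q = 0%E.
Proof.
have risk0 r : risk L [ffun=> 0] r = 0%E.
  by rewrite /risk /expect big1// => f _; rewrite ffunE mul0e.
by rewrite /divergence !risk0 sube0.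
Qed.

(** A value of [eta] outside [states P] is sent to [s0]; this happens only at null pairs, which add
    no mass. *)
Lemma law_SC_merge (s0 : states P) sc :
  law_SC P sc = \sum_(x | insubd s0 (eta P (x, sc.2)) == sc.1) law_XC P (x, sc.2).
Proof.
rewrite ffunE big_mkcond [RHS]big_mkcond/=; apply: eq_bigr => x _.
have [->|x0] := eqVneq (law_XC P (x, sc.2)) 0; first by rewrite !if_same.
rewrite -val_eqE insubdK//; apply: eta_states.
by rewrite lt_def x0; case: law_XC_pmf => ->.
Qed.

End States.

Theorem theorem4 (R : realType) (F X C : finType) (P : {ffun F * X * C -> R})
  (Q : set {ffun F -> R}) (L : {ffun F -> R} -> F -> \bar R)
  (Shat : {fset {ffun F -> R}}) (b D : R)
  (hP : is_pmf P)
  (hQ : forall q, Q q -> is_pmf q)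
  (hL : proper_loss Q L)
  (hS : forall s, s \in states P -> Q s)
  (hShat : forall t, t \in Shat -> Q t)
  (hfin : forall s t, s \in states P -> t \in Shat ->
     divergence L s t \is a fin_num)
  (hb : 1 < b)
  (hD : 0 <= D) :
  [/\ R_ind P L Shat b D = I_ind P L Shat b D,
      I_ind P L Shat b D = I_dir P L Shat b D &
      I_dir P L Shat b D = R_dir P L Shat b D].
Proof.
have hp := law_XC_pmf hP.
have [xc0 /eta_states s0] := pmf_exists_gt0 hp.
(* Some pair has positive mass, which supplies the default state. *)
pose sigma xc := insubd ([` s0]%fset : states P) (eta P xc).
have lawE sc : law_SC P sc = \sum_(x | sigma (x, sc.2) == sc.1) law_XC P (x, sc.2).
  exact: law_SC_merge.
have d_ind xc (t : Shat) : dist_ind P L xc t \is a fin_num.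
  have [x0|x0] := eqVneq (law_XC P xc) 0.
    by rewrite /dist_ind eta_null// divergence_null.
  apply: hfin; last exact: fsvalP.
  by apply: eta_states; rewrite lt_def x0; case: hp => ->.
have d_dir (sc : states P * C) (t : Shat) : dist_dir L sc t \is a fin_num.
  by apply: hfin; exact: fsvalP.
split.
- apply: (@operational_rateE _ _ _ _ _ _ (fun ac y => fine (dist_ind P L ac y))) => //.
  by move=> ac y; rewrite fineK.
- refine (information_rate_merge (sigma := sigma) hp lawE D hb d_ind d_dir _) => -[x c] t x0.
  congr (divergence L _ _); apply/esym.
  by have := insubdK [` s0]%fset (eta_states x0).
- apply/esym/(@operational_rateE _ _ _ _ _ _ (fun ac y => fine (dist_dir L ac y))) => //.
    exact: (merge_pmf (sigma := sigma) hp lawE).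
  by move=> ac y; rewrite fineK.
Qed.
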